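(* Let $\mathbb{k}$ be a field containing $\mathbb{Q}$ and let $\mathcal{T}=(A,B,\varepsilon)$ be a commutative triple over $\mathbb{k}$. Then there is an isomorphism of $\mathbb{k}$-vector spaces $$HH^1(A,B,\varepsilon)\cong \mathrm{Der}_{\mathbb{k}}(\mathcal{T},A^* ),$$ where $HH^1(A,B,\varepsilon)$ is the first secondary Hochschild cohomology associated to the triple and $\mathrm{Der}_{\mathbb{k}}(\mathcal{T},A^* )$ is the space of secondary derivations of $\mathcal{T}$ with values in $A^*=\mathrm{Hom}_{\mathbb{k}}(A,\mathbb{k})$.
   Context: Conventions: $\mathbb{k}$ is a field containing $\mathbb{Q}$, $\otimes=\otimes_{\mathbb{k}}$, and all $\mathbb{k}$-algebras are associative with unit. Triple: $(A,B,\varepsilon)$ is a triple if $A$ is a $\mathbb{k}$-algebra, $B$ is a commutative $\mathbb{k}$-algebra, and $\varepsilon:B\to A$ is a morphism of $\mathbb{k}$-algebras with $\varepsilon(B)\subseteq\mathcal{Z}(A)$ (the center of $A$). It is a commutative triple if $A$ is also commutative. Secondary Hochschild cohomology associated to a triple: it is the cohomology of a cochain complex with terms $\overline{C}^n(A,B,\varepsilon)=\mathrm{Hom}_{\mathbb{k}}(A^{\otimes n+1}\otimes B^{\otimes n(n+1)/2},\mathbb{k})$, $n\ge 0$. In low degree this complex is $$0\to \mathrm{Hom}_{\mathbb{k}}(A,\mathbb{k})\xrightarrow{\partial^0}\mathrm{Hom}_{\mathbb{k}}(A^{\otimes 2}\otimes B,\mathbb{k})\xrightarrow{\partial^1}\mathrm{Hom}_{\mathbb{k}}(A^{\otimes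 3}\otimes B^{\otimes 3},\mathbb{k})\to\cdots$$ with, for $a,b,c\in A$ and $\alpha,\beta,\gamma\in B$, $$\partial^0 f(a\otimes b\otimes\alpha)=f(a\varepsilon(\alpha)b)-f(b\varepsilon(\alpha)a),$$ $$\partial^1 f(a\otimes b\otimes c\otimes\alpha\otimes\beta\otimes\gamma)=f(a\varepsilon(\alpha)b\otimes c\otimes\beta\gamma)-f(a\otimes b\varepsilon(\gamma)c\otimes\alpha\beta)+f(c\varepsilon(\beta)a\otimes b\otimes\alpha\gamma).$$ Thus $HH^1(A,B,\varepsilon)=\mathrm{Ker}(\partial^1)/\mathrm{Im}(\partial^0)$. Secondary derivations: let $\mathcal{T}=(A,B,\varepsilon)$ be a commutative triple and $M$ a symmetric $A$-bimodule (equivalently an $A$-module), regarded as a symmetric $B\otimes A$-bimodule via $(\alpha\otimes a)\cdot m=a\varepsilon(\alpha)m=m\,a\varepsilon(\alpha)=m\cdot(\alpha\otimes a)$. A secondary derivation of $\mathcal{T}$ with values in $M$ is a $\mathbb{k}$-linear map $D:B\otimes A\to M$ such that for all $a,b\in A$, $\alpha,\beta\in B$: (1) $D((\alpha\otimes a)(\beta\otimes b))=a\varepsilon(\alpha)D(\beta\otimes b)+D(\alpha\otimes a)b\varepsilon(\beta)$, where $(\alpha\otimes a)(\beta\otimes b)=\alpha\beta\otimes ab$; and (2) $D(\alpha\otimes 1)+D(\alpha\otimes 1)=D(1\otimes\varepsilon(\alpha))$. The set of these is $\mathrm{Der}_{\mathbb{k}}(\mathcal{T},M)$, a $\mathbb{k}$-vector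 space under pointwise operations. Here $A^*=\mathrm{Hom}_{\mathbb{k}}(A,\mathbb{k})$ is an $A$-module via $(a\cdot\phi)(x)=\phi(xa)$. *)

(* Defs.v *)
From HB Require Import structures.
From mathcomp Require Import all_boot all_order all_algebra.
From mathcomp Require Import finmap boolp.
From mathcomp Require Import monalg.

Set Implicit Arguments.
Unset Strict Implicit.
Unset Printing Implicit Defensive.

Import GRing.Theory.

Local Open Scope ring_scope.

(* Unital associative algebras, the zero algebra included: GRing.Algebra, on  *)
(* the other hand, requires 1 != 0.                                           *)
Record pzAlgebra (k : fieldType) := PzAlgebra {
  alg_car : lmodType k;
  alg_one : alg_car;
  alg_mul : alg_car -> alg_car -> alg_car;
  alg_mulA : associative alg_mul;
  alg_mul1l : left_id alg_one alg_mul;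
  alg_mul1r : right_id alg_one alg_mul;
  alg_mulDl : left_distributive alg_mul +%R;
  alg_mulDr : right_distributive alg_mul +%R;
  alg_scaleAl : forall c x y, c *: alg_mul x y = alg_mul (c *: x) y;
  alg_scaleAr : forall c x y, c *: alg_mul x y = alg_mul x (c *: y)
}.

Definition alg_sort (k : fieldType) (A : pzAlgebra k) : Type := alg_car A.
Coercion alg_sort : pzAlgebra >-> Sortclass.

Section PzAlgebraTheory.
Variables (k : fieldType) (A : pzAlgebra k).

HB.instance Definition _ := GRing.Lmodule.on (alg_sort A).
HB.instance Definition _ := GRing.Zmodule_isPzRing.Build (alg_sort A)
  (@alg_mulA k A) (@alg_mul1l k A) (@alg_mul1r k A)
  (@alg_mulDl k A) (@alg_mulDr k A).

Lemma pzscalerAl (c : k) (x y : A) : (c *: x) * y = c *: (x * y).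
Proof. by rewrite [RHS]alg_scaleAl. Qed.

Lemma pzscalerAr (c : k) (x y : A) : x * (c *: y) = c *: (x * y).
Proof. by rewrite [RHS]alg_scaleAr. Qed.

End PzAlgebraTheory.

Definition to_linear (k : fieldType) (U V : lmodType k) (f : U -> V)
    (fL : linear f) : {linear U -> V} :=
  HB.pack f (GRing.isLinear.Build k U V *:%R f fL).

Section LinearMaps.
Variables (k : fieldType) (U V : lmodType k).

HB.instance Definition _ := gen_eqMixin {linear U -> V}.
HB.instance Definition _ := gen_choiceMixin {linear U -> V}.

Implicit Types f g h : {linear U -> V}.

Lemma linmapP f g : f =1 g -> f = g.
Proof.
move=> fg.
have E : (f : U -> V) = g by apply/funext.
case: f g fg E => f [[f1] [f2]] [g [[g1] [g2]]] _ /= E.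
case: _ / E g1 g2 => g1 g2.
by rewrite (Prop_irrelevance f1 g1) (Prop_irrelevance f2 g2).
Qed.

Definition lin0 : {linear U -> V} := \0.
Definition linD f g : {linear U -> V} := f \+ g.
Definition linN f : {linear U -> V} := \- f.
Definition linZ (c : k) f : {linear U -> V} := c \*: f.

Fact linDA : associative linD.
Proof. by move=> f g h; apply: linmapP => x /=; rewrite addrA. Qed.
Fact linDC : commutative linD.
Proof. by move=> f g; apply: linmapP => x /=; rewrite addrC. Qed.
Fact lin0D : left_id lin0 linD.
Proof. by move=> f; apply: linmapP => x /=; rewrite add0r. Qed.
Fact linND : left_inverse lin0 linN linD.
Proof. by move=> f; apply: linmapP => x /=; rewrite addNr. Qed.

HB.instance Definition _ :=
  GRing.isZmodule.Build {linear U -> V} linDA linDC lin0D linND.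

Fact linZA c d f : linZ c (linZ d f) = linZ (c * d) f.
Proof. by apply: linmapP => x /=; rewrite scalerA. Qed.
Fact lin1Z : left_id 1 linZ.
Proof. by move=> f; apply: linmapP => x /=; rewrite scale1r. Qed.
Fact linZDr : right_distributive linZ +%R.
Proof. by move=> c f g; apply: linmapP => x /=; rewrite scalerDr. Qed.
Fact linZDl f : {morph linZ^~ f : c d / c + d}.
Proof. by move=> c d; apply: linmapP => x /=; rewrite scalerDl. Qed.

HB.instance Definition _ :=
  GRing.Zmodule_isLmodule.Build k {linear U -> V} linZA lin1Z linZDr linZDl.

Lemma linDE f g x : (f + g) x = f x + g x. Proof. by []. Qed.
Lemma linNE f x : (- f) x = - f x. Proof. by []. Qed.
Lemma linBE f g x : (f - g) x = f x - g x. Proof. by []. Qed.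
Lemma linZE c f x : (c *: f) x = c *: f x. Proof. by []. Qed.

End LinearMaps.

Definition lcomp (k : fieldType) (U V W : lmodType k)
  (f : {linear V -> W}) (g : {linear U -> V}) : {linear U -> W} := f \o g.

Section KerIm.
Variables (k : fieldType) (U V : lmodType k) (f : {linear U -> V}).

Definition lker : {pred U} := fun x => f x == 0.
Definition limg : {pred V} := fun y => `[< exists x, f x = y >].

Lemma lkerP x : reflect (f x = 0) (x \in lker).
Proof. exact: eqP. Qed.

Lemma limgP y : reflect (exists x, f x = y) (y \in limg).
Proof. exact: asboolP. Qed.

Fact lker_closed : subsemimod_closed lker.
Proof.
split; [split=> [|x y]|move=> c x]; rewrite ?inE !unfold_in /lker.
- by rewrite linear0.
- by move=> /eqP fx /eqP fy; rewrite linearD fx fy addr0.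
- by move=> /eqP fx; rewrite linearZ /= fx scaler0.
Qed.
HB.instance Definition _ := GRing.isSubmodClosed.Build k U lker lker_closed.

Fact limg_closed : subsemimod_closed limg.
Proof.
split; [split=> [|x y]|move=> c x]; rewrite ?inE.
- by apply/limgP; exists 0; rewrite linear0.
- by move=> /limgP[x' <-] /limgP[y' <-]; apply/limgP; exists (x' + y'); rewrite linearD.
- by move=> /limgP[x' <-]; apply/limgP; exists (c *: x'); rewrite linearZ.
Qed.
HB.instance Definition _ := GRing.isSubmodClosed.Build k V limg limg_closed.

End KerIm.

Section Subspace.
Variables (k : fieldType) (V : lmodType k) (S : submodClosed V).

Definition subspace := {x : V | x \in S}.

HB.instance Definition _ := [isSub of subspace for @sval V (fun x => x \in S)].
HB.instance Definition _ := [Choice of subspace by <:].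
HB.instance Definition _ := 
  GRing.SubChoice_isSubLmodule.Build k V (fun x => x \in S) subspace
    (GRing.subsemimodClosedP S).

End Subspace.

Section QuotientSpace.
Variables (k : fieldType) (V : lmodType k) (S : submodClosed V).

Definition quot_pred : {pred V} := S.
HB.instance Definition _ :=
  GRing.isSubmodClosed.Build k V quot_pred (GRing.subsemimodClosedP S).

Local Open Scope quotient_scope.

Definition lquot := {ideal_quot quot_pred}.
HB.instance Definition _ := GRing.Zmodule.on lquot.

Definition lproj (x : V) : lquot := \pi_({ideal_quot quot_pred}) x.

Lemma lproj_eq x y : (lproj x = lproj y) <-> (x - y \in S).
Proof.
split; first by move=> /eqP; rewrite -Quotient.idealrBE.
by move=> xy; apply/eqP; rewrite -Quotient.idealrBE.
Qed.

Lemma lproj_surj (q : lquot) : exists x, lproj x = q.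
Proof. by exists (repr q); rewrite /lproj reprK. Qed.

Lemma lprojD : {morph lproj : x y / x + y}.
Proof. by move=> x y; rewrite /lproj; exact: (raddfD \pi). Qed.

Definition lquot_scale (c : k) (q : lquot) : lquot := lproj (c *: repr q).

Lemma lquot_scaleE c x : lquot_scale c (lproj x) = lproj (c *: x).
Proof.
apply/lproj_eq; rewrite -scalerBr; apply: rpredZ.
by apply/lproj_eq; rewrite /lproj reprK.
Qed.

Fact lquot_scaleA c d q :
  lquot_scale c (lquot_scale d q) = lquot_scale (c * d) q.
Proof. by have [x <-] := lproj_surj q; rewrite !lquot_scaleE scalerA. Qed.
Fact lquot_scale1 : left_id 1 lquot_scale.
Proof. by move=> q; have [x <-] := lproj_surj q; rewrite lquot_scaleE scale1r. Qed.
Fact lquot_scaleDr : right_distributive lquot_scale +%R.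
Proof.
move=> c p q; have [x <-] := lproj_surj p; have [y <-] := lproj_surj q.
by rewrite -lprojD !lquot_scaleE scalerDr lprojD.
Qed.
Fact lquot_scaleDl q : {morph lquot_scale^~ q : c d / c + d}.
Proof.
move=> c d; have [x <-] := lproj_surj q.
by rewrite !lquot_scaleE scalerDl lprojD.
Qed.
HB.instance Definition _ := GRing.Zmodule_isLmodule.Build k lquot
  lquot_scaleA lquot_scale1 lquot_scaleDr lquot_scaleDl.

Fact lproj_is_linear : linear lproj.
Proof. by move=> c x y; rewrite lprojD -lquot_scaleE. Qed.
HB.instance Definition _ := GRing.isLinear.Build k V lquot *:%R lproj
  lproj_is_linear.

End QuotientSpace.

Section Free.
Variables (k : fieldType) (X : choiceType) (W : lmodType k) (F : X -> W).

Definition free_ext (g : {malg k[X]}) : W := \sum_(x <- msupp g) g@_x *: F x.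

Lemma free_extw (d : {fset X}) (g : {malg k[X]}) : (msupp g `<=` d)%fset ->
  free_ext g = \sum_(x <- d) g@_x *: F x.
Proof.
move=> gd; rewrite /free_ext; apply/esym.
rewrite (big_fset_incl _ gd) // => x _ /mcoeff_outdom ->.
by rewrite scale0r.
Qed.

Lemma free_ext_is_linear : linear free_ext.
Proof.
move=> c g h; pose d := (msupp g `|` msupp h)%fset.
have gd : (msupp g `<=` d)%fset by rewrite fsubsetUl.
have hd : (msupp h `<=` d)%fset by rewrite fsubsetUr.
have ghd : (msupp (c *: g + h) `<=` d)%fset.
  apply: fsubset_trans (msuppD_le _ _) _.
  by rewrite fsetSU // msuppZ_le.
rewrite (free_extw gd) (free_extw hd) (free_extw ghd) scaler_sumr -big_split.
by apply: eq_bigr => x _ /=; rewrite mcoeffD mcoeffZ scalerDl scalerA.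
Qed.
HB.instance Definition _ := GRing.isLinear.Build k {malg k[X]} W *:%R free_ext
  free_ext_is_linear.

Lemma free_extU x : free_ext << x >> = F x.
Proof.
by rewrite (free_extw msuppU_le) big_seq_fset1 mcoeffUU scale1r.
Qed.

End Free.

Section Tensor.
Variables (k : fieldType) (U V : lmodType k).

Definition tens_rels (S : {malg k[(U * V)%type]} -> Prop) : Prop :=
  [/\ forall c u u' v,
        S (<< (c *: u + u', v) >> - (c *: << (u, v) >> + << (u', v) >>))
    & forall c u v v',
        S (<< (u, c *: v + v') >> - (c *: << (u, v) >> + << (u, v') >>))].

(* The subspace spanned by the bilinearity relations, as the intersection of  *)
(* all subspaces that contain them.                                           *)
Definition tens_ker : {pred {malg k[(U * V)%type]}} := fun x =>
  `[< forall S : submodClosed {malg k[(U * V)%type]},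
        tens_rels (fun y => y \in S) -> x \in S >].

Fact tens_ker_closed : subsemimod_closed tens_ker.
Proof.
split; [split=> [|x y]|move=> c x]; rewrite ?inE.
- by apply/asboolP => S _; exact: rpred0.
- move=> /asboolP Sx /asboolP Sy; apply/asboolP => S hS.
  by apply: rpredD; [exact: Sx|exact: Sy].
- by move=> /asboolP Sx; apply/asboolP => S hS; apply: rpredZ; exact: Sx.
Qed.
HB.instance Definition _ :=
  GRing.isSubmodClosed.Build k {malg k[(U * V)%type]} tens_ker tens_ker_closed.

Local Notation quo := (lquot tens_ker).
Local Notation pure u v := (lproj tens_ker << (u, v) >> : quo).

Fact tens_rels_ker : tens_rels (fun y => y \in tens_ker).
Proof. by split=> *; apply/asboolP => S [hl hr]; [exact: hl|exact: hr]. Qed.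

Let pure_linearl v : linear (fun u => pure u v).
Proof.
move=> c u u'; rewrite -linearP; apply/lproj_eq.
by have [hl _] := tens_rels_ker; exact: hl.
Qed.

Let pure_linearr u : linear (fun v => pure u v).
Proof.
move=> c v v'; rewrite -linearP; apply/lproj_eq.
by have [_ hr] := tens_rels_ker; exact: hr.
Qed.

Let pure_ind (P : quo -> Prop) :
  (forall u v, P (pure u v)) ->
  (forall c s t, P s -> P t -> P (c *: s + t)) -> forall t, P t.
Proof.
move=> Pt PD t; have [g <-] := lproj_surj t.
rewrite (monalgE g); elim/big_rec: _ => [|[u v] h _ Ph].
  by have := PD (-1) _ _ (Pt 0 0) (Pt 0 0); rewrite scaleN1r addNr raddf0.
have -> : << g@_(u, v) *g (u, v) >> =
    g@_(u, v) *: << (u, v) >> :> {malg k[(U * V)%type]}.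
  by apply/malgP => x; rewrite mcoeffZ !mcoeffU mulr_natr.
by rewrite linearP; apply: PD => //; exact: Pt.
Qed.

Definition bilin (W : lmodType k) (F : U -> V -> W) : Prop :=
  (forall v, linear (F^~ v)) /\ (forall u, linear (F u)).

Section Lift.
Variables (W : lmodType k) (F : U -> V -> W) (FL : bilin F).

Let L : {malg k[(U * V)%type]} -> W := free_ext (fun x => F x.1 x.2).
Let lift (t : quo) : W := L (repr t).

Let lift_proj g : lift (lproj tens_ker g) = L g.
Proof.
have LL : linear L by exact: free_ext_is_linear.
pose L' : {linear {malg k[(U * V)%type]} -> W} := to_linear LL.
have LU u v : L' << (u, v) >> = F u v by rewrite /= /L free_extU.
have h : repr (lproj tens_ker g) - g \in tens_ker.
  by apply/lproj_eq; rewrite /lproj reprK.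
apply/eqP; rewrite -subr_eq0 -[_ - _](linearB L').
move/asboolP: h => /(_ (lker L')); apply; case: FL => Fl Fr.
by split=> c x y z; apply/lkerP; rewrite linearB (linearP L') !LU ?Fl ?Fr subrr.
Qed.

Let lift_is_linear : linear lift.
Proof.
move=> c s t; have [g <-] := lproj_surj s; have [h <-] := lproj_surj t.
by rewrite -linearP !lift_proj /L linearP.
Qed.

Fact quo_lift : {f : {linear quo -> W} | forall u v, f (pure u v) = F u v}.
Proof.
exists (to_linear lift_is_linear).
by move=> u v; rewrite /= lift_proj /L free_extU.
Qed.

End Lift.

(* A tensor product of U and V, by its universal property; the uniqueness of  *)
(* the linear map induced by a bilinear one amounts to tp_ind.                *)
Record tensor_product := TensorProduct {
  tp_car : lmodType k;
  tp_pure : U -> V -> tp_car;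
  tp_bilin : bilin tp_pure;
  tp_ind : forall P : tp_car -> Prop,
    (forall u v, P (tp_pure u v)) ->
    (forall c s t, P s -> P t -> P (c *: s + t)) -> forall t, P t;
  tp_lift : forall (W : lmodType k) (F : U -> V -> W), bilin F ->
    {f : {linear tp_car -> W} | forall u v, f (tp_pure u v) = F u v}
}.

(* The quotient of the free vector space on U * V; this is kept opaque, so    *)
(* that unification does not unfold it.                                       *)
Lemma tensor_construction : tensor_product.
Proof.
exact: (@TensorProduct quo (fun u v => pure u v)
  (conj pure_linearl pure_linearr) pure_ind quo_lift).
Qed.

Definition tensor : lmodType k := tp_car tensor_construction.
Definition tens (u : U) (v : V) : tensor := tp_pure tensor_construction u v.

Lemma tens_linearl v : linear (tens^~ v).
Proof. by case: (tp_bilin tensor_construction). Qed.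

Lemma tens_linearr u : linear (tens u).
Proof. by case: (tp_bilin tensor_construction). Qed.

Lemma tens_ind (P : tensor -> Prop) :
  (forall u v, P (tens u v)) ->
  (forall c s t, P s -> P t -> P (c *: s + t)) -> forall t, P t.
Proof. exact: tp_ind. Qed.

Lemma tens_eq (W : lmodType k) (f g : {linear tensor -> W}) :
  (forall u v, f (tens u v) = g (tens u v)) -> f =1 g.
Proof.
move=> fg; apply: tens_ind => // c s t fgs fgt.
by rewrite !linearP fgs fgt.
Qed.

Definition lift2 (W : lmodType k) (F : U -> V -> W) (FL : bilin F) :
  {linear tensor -> W} := sval (tp_lift tensor_construction FL).

Lemma lift2E (W : lmodType k) (F : U -> V -> W) (FL : bilin F) u v :
  lift2 FL (tens u v) = F u v.
Proof. exact: (svalP (tp_lift tensor_construction FL)). Qed.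

End Tensor.

Notation "U ⨂ V" := (tensor U V) (at level 40, left associativity).
Notation "u ⊗ v" := (tens u v) (at level 40, left associativity) : ring_scope.

Lemma tens3_ind (k : fieldType) (U V X : lmodType k)
    (P : (U ⨂ V) ⨂ X -> Prop) :
  (forall u v x, P ((u ⊗ v) ⊗ x)) ->
  (forall c s t, P s -> P t -> P (c *: s + t)) -> forall t, P t.
Proof.
move=> Pt PD t; elim/tens_ind: t => [t x|c s t Ps Pt']; last exact: PD.
elim/tens_ind: t => [u v|c s t Ps Pt']; first exact: Pt.
by rewrite tens_linearl; exact: PD.
Qed.

Section LinearFamilies.
Variables (k : fieldType) (U V X Y W : lmodType k).

Let famP (T : lmodType k) (G : Y -> {linear T -> W}) c s t :
  linear (fun y => G y s) -> linear (fun y => G y t) ->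
  linear (fun y => G y (c *: s + t)).
Proof.
move=> hs ht d x y; rewrite !(linearP (G _)) hs ht.
by rewrite !scalerDr !scalerA mulrC addrACA.
Qed.

Lemma tens_family (G : Y -> {linear U ⨂ V -> W}) :
  (forall u v, linear (fun y => G y (u ⊗ v))) -> forall t, linear (fun y => G y t).
Proof. by move=> h t; elim/tens_ind: t => // c s t; exact: famP. Qed.

Lemma tens3_family (G : Y -> {linear (U ⨂ V) ⨂ X -> W}) :
  (forall u v x, linear (fun y => G y ((u ⊗ v) ⊗ x))) ->
  forall t, linear (fun y => G y t).
Proof. by move=> h t; elim/tens3_ind: t => // c s t; exact: famP. Qed.

End LinearFamilies.

Section Lift3.
Variables (k : fieldType) (U V X W : lmodType k) (F : U -> V -> X -> W).

Definition trilin := [/\ forall v x, linear (fun u => F u v x),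
  forall u x, linear (fun v => F u v x) & forall u v, linear (F u v)].

Hypothesis FL : trilin.

Fact lift3_aux1 x : bilin (fun u v => F u v x).
Proof. by case: FL. Qed.

Fact lift3_aux2 : bilin (fun t x => lift2 (lift3_aux1 x) t).
Proof.
split=> [x|]; first exact: linearP.
apply: tens_family => u v c x y.
by rewrite 3!lift2E; case: FL => _ _; apply.
Qed.

Definition lift3 : {linear (U ⨂ V) ⨂ X -> W} := lift2 lift3_aux2.

Lemma lift3E u v x : lift3 ((u ⊗ v) ⊗ x) = F u v x.
Proof. by rewrite /lift3 !lift2E. Qed.

End Lift3.

Section Lift33.
Variables (k : fieldType) (U1 U2 U3 V1 V2 V3 W : lmodType k).
Variable F : U1 -> U2 -> U3 -> V1 -> V2 -> V3 -> W.

Definition hexalin :=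
  (forall u1 u2 u3, trilin (F u1 u2 u3)) /\
  (forall v1 v2 v3, trilin (fun u1 u2 u3 => F u1 u2 u3 v1 v2 v3)).

Hypothesis FL : hexalin.

Fact lift33_aux1 u1 u2 u3 : trilin (F u1 u2 u3).
Proof. by case: FL. Qed.

Fact lift33_aux2 t : trilin (fun u1 u2 u3 => lift3 (lift33_aux1 u1 u2 u3) t).
Proof.
have L v1 v2 v3 := proj2 FL v1 v2 v3.
split=> [u2 u3|u1 u3|u1 u2]; apply: tens3_family => v1 v2 v3 c x y;
  by rewrite 3!lift3E; case: (L v1 v2 v3) => l1 l2 l3;
     (exact: l1 || exact: l2 || exact: l3).
Qed.

Fact lift33_aux3 : bilin (fun s t => lift3 (lift33_aux2 t) s).
Proof.
split=> [t|]; first exact: linearP.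
apply: tens3_family => u1 u2 u3 c x y.
by rewrite 3!lift3E; exact: linearP.
Qed.

Definition lift33 : {linear ((U1 ⨂ U2) ⨂ U3) ⨂ ((V1 ⨂ V2) ⨂ V3) -> W} :=
  lift2 lift33_aux3.

Lemma lift33E u1 u2 u3 v1 v2 v3 :
  lift33 (((u1 ⊗ u2) ⊗ u3) ⊗ ((v1 ⊗ v2) ⊗ v3)) = F u1 u2 u3 v1 v2 v3.
Proof. by rewrite /lift33 lift2E !lift3E. Qed.

End Lift33.

Lemma tens33_eq (k : fieldType) (U1 U2 U3 V1 V2 V3 W : lmodType k)
    (f g : {linear ((U1 ⨂ U2) ⨂ U3) ⨂ ((V1 ⨂ V2) ⨂ V3) -> W}) :
  (forall u1 u2 u3 v1 v2 v3,
     f (((u1 ⊗ u2) ⊗ u3) ⊗ ((v1 ⊗ v2) ⊗ v3)) =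
     g (((u1 ⊗ u2) ⊗ u3) ⊗ ((v1 ⊗ v2) ⊗ v3))) -> f =1 g.
Proof.
move=> fg; apply: tens_eq => s t.
elim/tens3_ind: s => [u1 u2 u3|c s s' hs hs'].
  elim/tens3_ind: t => [v1 v2 v3|c t t' ht ht']; first exact: fg.
  by rewrite tens_linearr (linearP f) (linearP g) ht ht'.
by rewrite tens_linearl (linearP f) (linearP g) hs hs'.
Qed.

Record triple (k : fieldType) := Triple {
  tA : pzAlgebra k;
  tB : pzAlgebra k;
  tB_comm : commutative (@GRing.mul tB);
  teps : {linear tB -> tA};
  teps_morph : monoid_morphism teps;
  teps_central : forall (b : tB) (a : tA), teps b * a = a * teps b
}.

Definition commutative_triple (k : fieldType) (T : triple k) : Prop :=
  commutative (@GRing.mul (tA T)).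

Section SecondaryCohomology.
Variables (k : fieldType) (T : triple k).
Local Notation A := (tA T).
Local Notation B := (tB T).
Local Notation eps := (teps T).

Definition C0 : lmodType k := {linear A -> k^o}.
Definition C1 : lmodType k := {linear (A ⨂ A) ⨂ B -> k^o}.
Definition C2 : lmodType k :=
  {linear ((A ⨂ A) ⨂ A) ⨂ ((B ⨂ B) ⨂ B) -> k^o}.

Definition face00 (a b : A) (x : B) : A := a * eps x * b.
Definition face01 (a b : A) (x : B) : A := b * eps x * a.

Definition face10 (a b c : A) (x y z : B) : (A ⨂ A) ⨂ B :=
  ((a * eps x * b) ⊗ c) ⊗ (y * z).
Definition face11 (a b c : A) (x y z : B) : (A ⨂ A) ⨂ B :=
  (a ⊗ (b * eps z * c)) ⊗ (x * y).
Definition face12 (a b c : A) (x y z : B) : (A ⨂ A) ⨂ B :=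
  ((c * eps y * a) ⊗ b) ⊗ (x * z).

Fact face00_lin : trilin face00.
Proof.
by split=> ? ? c u v;
  rewrite /face00 ?linearP ?(mulrDl, mulrDr, pzscalerAl, pzscalerAr).
Qed.

Fact face01_lin : trilin face01.
Proof.
by split=> ? ? c u v;
  rewrite /face01 ?linearP ?(mulrDl, mulrDr, pzscalerAl, pzscalerAr).
Qed.

Fact face10_lin : hexalin face10.
Proof.
by split=> ? ? ?; split=> ? ? s u v;
  rewrite /face10 ?linearP ?(mulrDl, mulrDr, pzscalerAl, pzscalerAr)
    ?(tens_linearl, tens_linearr).
Qed.

Fact face11_lin : hexalin face11.
Proof.
by split=> ? ? ?; split=> ? ? s u v;
  rewrite /face11 ?linearP ?(mulrDl, mulrDr, pzscalerAl, pzscalerAr)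
    ?(tens_linearl, tens_linearr).
Qed.

Fact face12_lin : hexalin face12.
Proof.
by split=> ? ? ?; split=> ? ? s u v;
  rewrite /face12 ?linearP ?(mulrDl, mulrDr, pzscalerAl, pzscalerAr)
    ?(tens_linearl, tens_linearr).
Qed.

Definition d0_fun (f : C0) : C1 :=
  lcomp f (lift3 face00_lin) - lcomp f (lift3 face01_lin).

Definition d1_fun (f : C1) : C2 :=
  lcomp f (lift33 face10_lin) - lcomp f (lift33 face11_lin)
    + lcomp f (lift33 face12_lin).

Fact d0_is_linear : linear d0_fun.
Proof.
move=> c f g; apply: linmapP => t; rewrite !linDE linZE !linNE /=.
by rewrite scalerDr scalerN opprD addrACA.
Qed.

Fact d1_is_linear : linear d1_fun.
Proof.
move=> c f g; apply: linmapP => t; rewrite !linDE linZE !linDE !linNE /=.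
by rewrite !scalerDr scalerN opprD (addrACA (c *: _)) (addrACA (_ + _)).
Qed.

Definition d0 : {linear C0 -> C1} := to_linear d0_is_linear.
Definition d1 : {linear C1 -> C2} := to_linear d1_is_linear.

Lemma d0E (f : C0) a b x :
  d0 f ((a ⊗ b) ⊗ x) = f (a * eps x * b) - f (b * eps x * a).
Proof.
transitivity (f (lift3 face00_lin ((a ⊗ b) ⊗ x))
              - f (lift3 face01_lin ((a ⊗ b) ⊗ x))) => //.
by rewrite !lift3E.
Qed.

Lemma d1E (f : C1) a b c x y z :
  d1 f (((a ⊗ b) ⊗ c) ⊗ ((x ⊗ y) ⊗ z)) =
    f (((a * eps x * b) ⊗ c) ⊗ (y * z))
    - f ((a ⊗ (b * eps z * c)) ⊗ (x * y))
    + f (((c * eps y * a) ⊗ b) ⊗ (x * z)).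
Proof.
pose t := ((a ⊗ b) ⊗ c) ⊗ ((x ⊗ y) ⊗ z).
transitivity (f (lift33 face10_lin t) - f (lift33 face11_lin t)
              + f (lift33 face12_lin t)) => //.
by rewrite /t !lift33E.
Qed.

Lemma d1d0 (f : C0) : d1 (d0 f) = 0.
Proof.
have [_ eM] := teps_morph T; have eC := @teps_central k T.
apply/linmapP/tens33_eq => a b c x y z.
have e2 (u v : A) r s : u * eps (r * s) * v = u * eps r * v * eps s.
  by rewrite eM -!mulrA (eC s).
rewrite d1E !d0E !mulrA.
have -> : a * eps (x * y) * b * eps z * c = a * eps x * b * eps (y * z) * c.
  by rewrite e2 eM !mulrA.
have -> : c * eps y * a * eps (x * z) * b = c * eps (y * z) * a * eps x * b.
  by rewrite (tB_comm x z) (e2 c a) (eM z) !mulrA.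
have -> : b * eps (x * z) * c * eps y * a = b * eps z * c * eps (x * y) * a.
  by rewrite (tB_comm x z) (e2 b c) (eM x) !mulrA.
have alt (p q r : k^o) : p - q - (p - r) + (q - r) = 0.
  by rewrite opprB (addrC (p - q)) (addrA (r - p)) subrK (addrA (r - q)) subrK subrr.
exact: alt.
Qed.

Fact d0_in_ker f : d0 f \in lker d1.
Proof. by apply/lkerP; exact: d1d0. Qed.

Definition d0_ker_fun (f : C0) : subspace (lker d1) := exist _ (d0 f) (d0_in_ker f).

Fact d0_ker_is_linear : linear d0_ker_fun.
Proof. by move=> c f g; apply: val_inj; rewrite /= -[LHS]/(d0 _) linearP. Qed.

Definition d0_ker : {linear C0 -> subspace (lker d1)} := to_linear d0_ker_is_linear.

Definition HH1 : lmodType k := lquot (limg d0_ker).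

End SecondaryCohomology.

Record amodule (k : fieldType) (A : pzAlgebra k) := AModule {
  am_car :> lmodType k;
  act : A -> am_car -> am_car;
  act_linearl : forall m, linear (act^~ m);
  act_linearr : forall a, linear (act a);
  act1 : forall m, act 1 m = m;
  actM : forall a b m, act (a * b) m = act a (act b m)
}.

Section SecondaryDerivations.
Variables (k : fieldType) (T : triple k) (M : amodule (tA T)).
Local Notation A := (tA T).
Local Notation B := (tB T).
Local Notation eps := (teps T).

(* The values are in M seen as a symmetric bimodule, for which the right      *)
(* action m . a is act a m. The first condition is the Leibniz rule on        *)
(* products of pure tensors, (x ⊗ a) * (y ⊗ b) being (x * y) ⊗ (a * b).       *)
Definition is_secder (D : {linear B ⨂ A -> M}) : Prop :=
  (forall (a b : A) (x y : B),
     D ((x * y) ⊗ (a * b)) =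
       act (a * eps x) (D (y ⊗ b)) + act (b * eps y) (D (x ⊗ a))) /\
  (forall x : B, D (x ⊗ (1 : A)) + D (x ⊗ (1 : A)) = D ((1 : B) ⊗ eps x)).

Definition secder : {pred {linear B ⨂ A -> M}} := fun D => `[< is_secder D >].

Fact secder_closed : subsemimod_closed secder.
Proof.
pose L a := to_linear (@act_linearr k A M a).
have act0 a : act a (0 : M) = 0 by exact: (linear0 (L a)).
have actD a (m n : M) : act a (m + n) = act a m + act a n.
  exact: (linearD (L a)).
have actZ a c (m : M) : act a (c *: m) = c *: act a m.
  exact: (linearZ_LR (L a)).
split; [split=> [|D E]|move=> c D]; rewrite ?inE.
- by apply/asboolP; split=> *; rewrite ?act0 /= ?addr0 ?act0 ?addr0.
- move=> /asboolP[D1 D2] /asboolP[E1 E2]; apply/asboolP; split=> *.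
    by rewrite !linDE D1 E1 !actD addrACA.
  by rewrite !linDE addrACA D2 E2.
- move=> /asboolP[D1 D2]; apply/asboolP; split=> *.
    by rewrite !linZE D1 !actZ scalerDr.
  by rewrite !linZE -scalerDr D2.
Qed.
HB.instance Definition _ := GRing.isSubmodClosed.Build k {linear B ⨂ A -> M}
  secder secder_closed.

Definition Der : lmodType k := subspace secder.

End SecondaryDerivations.
Arguments Der {k} T M.

Section Dual.
Variables (k : fieldType) (A : pzAlgebra k).

Fact mulr_is_linear (a : A) : linear (fun x : A => x * a).
Proof. by move=> c x y; rewrite mulrDl pzscalerAl. Qed.

Definition dual_act (a : A) (f : {linear A -> k^o}) : {linear A -> k^o} :=
  lcomp f (to_linear (mulr_is_linear a)).

Lemma dual_actE a f x : dual_act a f x = f (x * a).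
Proof. by []. Qed.

Fact dual_linearl f : linear (dual_act^~ f).
Proof.
move=> c a b; apply: linmapP => x.
by rewrite linDE linZE !dual_actE mulrDr pzscalerAr linearP.
Qed.

Fact dual_linearr a : linear (dual_act a).
Proof. by move=> c f g; apply: linmapP => x. Qed.

Fact dual_act1 f : dual_act 1 f = f.
Proof. by apply: linmapP => x; rewrite dual_actE mulr1. Qed.

Fact dual_actM a b f : dual_act (a * b) f = dual_act a (dual_act b f).
Proof. by apply: linmapP => x; rewrite !dual_actE mulrA. Qed.

Definition dual : amodule A :=
  AModule dual_linearl dual_linearr dual_act1 dual_actM.

End Dual.

(* Main.v *)
(** Both spaces consist of the same trilinear forms, through
    [f (a ⊗ b ⊗ x) = D (x ⊗ b) a], and [d0] vanishes because [A] is
    commutative, so that [HH1] is the space of cocycles.  The cocycle equation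
    at [z = 1] is the Leibniz rule for [D], and at [b = c = 1], [x = y = 1] it
    is the second axiom of a secondary derivation.  Conversely, expanding the
    three terms of the cocycle equation by the Leibniz rule leaves
    [D (1 ⊗ eps z) = 2 D (z ⊗ 1)] to be checked. *)
Require Import Defs.
From mathcomp Require Import all_boot all_order all_algebra.
From mathcomp Require Import boolp.

Set Implicit Arguments.
Unset Strict Implicit.
Unset Printing Implicit Defensive.

Import GRing.Theory.

Local Open Scope ring_scope.

(** Derivations map to classes of forms without any choice of representative, so the isomorphism is
    built in that direction and then reversed. *)
Lemma bij_linear_inverse (k : fieldType) (U V : lmodType k)
    (f : {linear U -> V}) :
  bijective f -> exists g : {linear V -> U}, bijective g.
Proof.
case=> g fK gK.
have gL : linear g by move=> c x y; apply: (can_inj fK); rewrite linearP !gK.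
by exists (to_linear gL); exists f.
Qed.

Lemma inj_surj_bij (U V : Type) (f : U -> V) :
  injective f -> (forall y, exists x, f x = y) -> bijective f.
Proof.
move=> f_inj f_surj; have [g gK] := choice f_surj.
by exists g => // x; apply: f_inj; rewrite gK.
Qed.

Section CocyclesAndDerivations.
Variables (k : fieldType) (T : triple k) (T_comm : commutative_triple T).
Local Notation A := (tA T).
Local Notation B := (tB T).
Local Notation eps := (teps T).
Local Notation dA := (dual A).

Fact form_of_trilin (D : {linear B ⨂ A -> dA}) :
  trilin (fun (a b : A) (x : B) => D (x ⊗ b) a : k^o).
Proof.
split=> [b x|a x|a b] c u v; first exact: linearP.
  by rewrite tens_linearr linearP.
by rewrite tens_linearl linearP.
Qed.

Definition form_of (D : {linear B ⨂ A -> dA}) : C1 T :=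
  lift3 (form_of_trilin D).

Lemma form_ofE D a b x : form_of D ((a ⊗ b) ⊗ x) = D (x ⊗ b) a.
Proof. exact: lift3E. Qed.

Lemma tens3_eq (f g : C1 T) :
  (forall a b x, f ((a ⊗ b) ⊗ x) = g ((a ⊗ b) ⊗ x)) -> f = g.
Proof.
move=> fg; apply: linmapP; apply: tens3_ind => // c s t fgs fgt.
by rewrite !linearP fgs fgt.
Qed.

Fact form_of_is_linear : linear form_of.
Proof.
by move=> c D E; apply: tens3_eq => a b x; rewrite linDE linZE !form_ofE.
Qed.

Lemma form_of_inj : injective form_of.
Proof.
move=> D E DE; apply/linmapP/tens_eq => x b; apply: linmapP => a.
by rewrite -!form_ofE DE.
Qed.

(** Freezing [b] and [x] in [f] leaves a functional of [a]; it depends bilinearly on [(x, b)], hence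
    extends to the tensor product. *)
Lemma form_of_surj (f : C1 T) : exists D, form_of D = f.
Proof.
have sliceL b x : linear (fun a : A => f ((a ⊗ b) ⊗ x)).
  by move=> c u v; rewrite !tens_linearl linearP.
have FL : bilin (fun x b => to_linear (sliceL b x) : dA).
  split=> ? c u v; apply: linmapP => a; rewrite linDE linZE /=.
    by rewrite tens_linearr linearP.
  by rewrite tens_linearr tens_linearl linearP.
exists (lift2 FL); apply: tens3_eq => a b x.
by rewrite form_ofE lift2E.
Qed.

(** The equation on the left is the cocycle condition for [form_of D] on pure tensors, its negative
    middle term moved to the other side. *)
Lemma secderP (D : {linear B ⨂ A -> dA}) :
  (forall (a b c : A) (x y z : B),
     D ((x * y) ⊗ (b * eps z * c)) a =
       D ((y * z) ⊗ c) (a * eps x * b) + D ((x * z) ⊗ b) (c * eps y * a)) <->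
  is_secder D.
Proof.
have [e1 eM] := teps_morph T.
have AC : right_commutative (@GRing.mul A).
  by move=> u v w; rewrite -!mulrA (T_comm v).
split=> [H|[leib D2] a b c x y z].
  split=> [a b x y|x]; apply: linmapP => u; rewrite linDE.
    have := H u a b x y 1; rewrite !mulr1 e1 mulr1 => ->.
    by rewrite !dual_actE !mulrA (AC u a) (T_comm (b * _)) mulrA.
  have := H u 1 1 1 1 x; rewrite !mul1r !mulr1 e1 mulr1 mul1r => E.
  exact: esym E.
(* Leibniz splits off the factor [1 ⊗ eps z], whose derivative the second axiom turns into twice
   that of [z ⊗ 1]. *)
have D1z v : D ((x * y) ⊗ (eps z * v)) =
    dual_act (eps z) (D ((x * y) ⊗ v)) +
    dual_act (v * eps (x * y)) (D (z ⊗ (1 : A)) + D (z ⊗ (1 : A))).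
  by have := leib (eps z) v 1 (x * y); rewrite mul1r e1 mulr1 D2.
have Dz w v : D ((w * z) ⊗ v) =
    dual_act (eps z) (D (w ⊗ v)) + dual_act (v * eps w) (D (z ⊗ (1 : A))).
  have := leib v 1 w z; rewrite mulr1 mul1r => ->; exact: addrC.
rewrite (T_comm b) -(mulrA (eps z)) D1z leib !Dz.
rewrite !linDE !dual_actE !linDE !dual_actE eM !mulrA.
(* Once the arguments are put in a common order, the two copies of [D (z ⊗ 1)] on the left match the
   one from each term on the right. *)
rewrite (AC a (eps z) b) (AC (a * b) (eps z)) (AC a b (eps x)).
rewrite (AC a (eps z) c) (AC (a * c) (eps z)) (T_comm a c) (AC c a (eps y)).
rewrite (AC a (eps x) b) (AC (a * b) (eps x) c).
rewrite (AC c (eps y) a) (T_comm c a) (AC (a * c) (eps y) b) (AC a c b).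
rewrite (AC (a * b * c) (eps y)).
exact: addrACA.
Qed.

Lemma secder_cocycle (D : {linear B ⨂ A -> dA}) :
  (D \in secder (M := dA)) = (form_of D \in Defs.lker (d1 T)).
Proof.
apply/asboolP/Defs.lkerP => [/secderP H|H].
  apply/linmapP/tens33_eq => a b c x y z.
  by rewrite d1E !form_ofE H addrAC subrr.
apply/secderP => a b c x y z.
have /eqP := d1E (form_of D) a b c x y z.
by rewrite H !form_ofE eq_sym addrAC subr_eq0 => /eqP.
Qed.

Lemma d0_comm f : d0 T f = 0.
Proof.
apply: tens3_eq => a b x.
by rewrite d0E (T_comm (b * _)) (T_comm b) mulrA subrr.
Qed.

End CocyclesAndDerivations.

Theorem theorem3p6 (k : fieldType) (k_char0 : [pchar k] =i pred0)
    (T : triple k) (T_comm : commutative_triple T) :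
  exists phi : {linear HH1 T -> Der T (dual (tA T))}, bijective phi.
Proof.
pose form_Der (D : Der T (dual (tA T))) : subspace (Defs.lker (d1 T)) :=
  exist _ (form_of (val D)) (etrans (esym (secder_cocycle T_comm _)) (valP D)).
have psiL : linear (fun D => lproj (Defs.limg (d0_ker T)) (form_Der D)).
  move=> c D E; rewrite -linearP; congr lproj; apply: val_inj.
  exact: form_of_is_linear.
apply: (bij_linear_inverse (f := to_linear psiL)).
(* Forms with the same class differ by some [d0 f], which is zero. *)
apply: inj_surj_bij => [D E /lproj_eq/Defs.limgP[f fDE]|q].
  apply/val_inj/form_of_inj/eqP; rewrite -subr_eq0 -(d0_comm T_comm f).
  by apply/eqP/esym; have := congr1 val fDE; exact.
(* A cocycle representing [q] is the form of some [D], which is then a secondary derivation. *)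
have [z <-] := lproj_surj q; have [D Dz] := form_of_surj (val z).
have D_der : D \in secder (M := dual (tA T)).
  by rewrite (secder_cocycle T_comm) Dz; exact: valP z.
exists (exist _ D D_der : Der T _); congr lproj; exact: val_inj.
Qed.
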